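(* For any positive integer $n$, we have $$\sum_{k=0}^{n-1} (8k+5)T_k^2 \equiv 0 \pmod{n}.$$ If $p$ is a prime, then $$\sum_{k=0}^{p-1} (8k+5)T_k^2 \equiv 3p \left( \frac{p}{3} \right) \pmod{p^2}.$$
   Context: For $n\in\{0,1,2,\ldots\}$, the central trinomial coefficient $T_n$ is the coefficient of $x^n$ in the expansion of $(x^2+x+1)^n$. Here $\left(\frac{\cdot}{3}\right)$ is the Legendre symbol modulo $3$, so $\left(\frac{p}{3}\right)\in\{0,1,-1\}$ is congruent to $p$ modulo $3$. *)

(* Defs.v *)
From mathcomp Require Import all_boot all_order all_algebra.

Set Implicit Arguments.
Unset Strict Implicit.
Unset Printing Implicit Defensive.

Import GRing.Theory.
Local Open Scope ring_scope.

Definition central_trinomial (n : nat) : int :=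
  (('X^2 + 'X + 1 : {poly int}) ^+ n)`_n.

(* Only meaningful for an odd prime [q]. *)
Definition legendre (a : int) (q : nat) : int :=
  if (q%:Z %| a)%Z then 0
  else if [exists x : 'I_q, ((x%:Z ^+ 2)%R == a %[mod q%:Z])%Z] then 1
  else -1.

(* Main.v *)
(** Put [P = X^2 + X + 1], and let [T_n] and [d_n] be the coefficients of [X^n]
    and [X^(n+1)] in [P^n].  Comparing coefficients in [P (P^n)' = n P' P^n]
    gives [T_(n+1) = T_n + 2 d_n] and
    [(n + 2) d_(n+1) = (n + 1) (2 T_n + d_n)], and with these recurrences the
    sum telescopes:
    [\sum_(k < n) (8 k + 5) T_k^2
       = 2 n^2 (d_(n-1) - T_(n-1))^2 + 3 n T_(n-1) T_n].
    Divisibility by [n] is then visible, and modulo [p^2] only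
    [T_(p-1) T_p] modulo [p] matters.  In characteristic [p],
    [P^p = X^(2p) + X^p + 1] gives [T_p = 1]; writing [P P^(p-1) = P^p] shows
    that the coefficients of [P^(p-1)] below [X^p] are [1, -1, 0, 1, -1, 0, ...],
    so [T_(p-1) = (p/3)]. *)

Require Import Defs.
From mathcomp Require Import all_boot all_order all_algebra.
From mathcomp Require Import ring zify.
Import GRing.Theory.

Local Open Scope ring_scope.

(** The ring is a parameter so that the same polynomial serves over [int] and in characteristic
    [p]. *)
Definition trinomial (R : nzRingType) : {poly R} := 'X^2 + 'X + 1.

Lemma coef_trinomialM (R : nzRingType) (f : {poly R}) (k : nat) :
  (trinomial R * f)`_k.+2 = f`_k + f`_k.+1 + f`_k.+2.
Proof. by rewrite /trinomial !mulrDl mul1r !coefD coefXnM coefXM /= subn2. Qed.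

Lemma coef_trinomialM1 (R : nzRingType) (f : {poly R}) :
  (trinomial R * f)`_1 = f`_0 + f`_1.
Proof. by rewrite /trinomial !mulrDl mul1r !coefD coefXnM coefXM /= add0r. Qed.

Lemma coef_trinomialM0 (R : nzRingType) (f : {poly R}) :
  (trinomial R * f)`_0 = f`_0.
Proof. by rewrite /trinomial !mulrDl mul1r !coefD coefXnM coefXM /= !add0r. Qed.

Lemma deriv_trinomialX (R : comNzRingType) (n : nat) :
  trinomial R * (trinomial R ^+ n)^`()
    = ('X * trinomial R ^+ n *+ 2 + trinomial R ^+ n) *+ n.
Proof.
case: n => [|n]; first by rewrite expr0 derivC mulr0 mulr0n.
rewrite deriv_exp /= mulrnAr mulrCA -exprS; congr (_ *+ _).
rewrite {1}/trinomial !derivD derivXn derivX derivC addr0 expr1.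
by rewrite mulrDl mul1r mulrnAl.
Qed.

Lemma coef_trinomialX_rec (R : comNzRingType) (n k : nat)
    (f := trinomial R ^+ n) :
  k%:R * f`_k + k.+1%:R * f`_k.+1 + k.+2%:R * f`_k.+2
    = n%:R * (2 * f`_k + f`_k.+1).
Proof.
have /(congr1 (fun f : {poly R} => f`_k.+1)) := deriv_trinomialX R n.
rewrite coefMn coefD coefMn coefXM /= !mulr_natl => <-.
(* For [k = 0] the product has only two terms in degree 1; the missing one matches the vanishing
   summand [0 * f_0]. *)
case: k => [|k]; last by rewrite coef_trinomialM !coef_deriv.
by rewrite coef_trinomialM1 !coef_deriv mulr0n add0r.
Qed.

Definition next_coef (n : nat) : int := (trinomial int ^+ n)`_n.+1.

(* The recurrence at index [n - 1] forces the two neighbours of the central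
   coefficient of [trinomial int ^+ n] to be equal. *)
Lemma central_trinomialS (n : nat) :
  central_trinomial n.+1 = central_trinomial n + 2 * next_coef n.
Proof.
rewrite /central_trinomial /next_coef -!/(trinomial int) exprS.
case: n => [|n]; first by rewrite coef_trinomialM1 expr0 !coef1.
rewrite coef_trinomialM.
suff step (m a b c : int) : m + 2 != 0 ->
    m * a + (1 + m) * b + (1 + (1 + m)) * c = (1 + m) * (2 * a + b) ->
    a + b + c = b + 2 * c.
  apply: (step n%:Z); first by lia.
  rewrite -!intS -!natz; exact: coef_trinomialX_rec.
move=> m2_neq0 E; suff -> : c = a by ring.
apply: (mulfI m2_neq0).
have -> : (m + 2) * c = m * a + (1 + m) * b + (1 + (1 + m)) * c
  - m * a - (1 + m) * b by ring.
rewrite E; ring.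
Qed.

(** The recurrence at index [n] determines [n + 2] times the coefficient of [X^(n+2)] in
    [trinomial int ^+ n], the only unknown in [next_coef n.+1]. *)
Lemma next_coefS (n : nat) :
  (n%:Z + 2) * next_coef n.+1
    = (n%:Z + 1) * (2 * central_trinomial n + next_coef n).
Proof.
rewrite /central_trinomial /next_coef -!/(trinomial int) exprS.
rewrite coef_trinomialM.
suff step (m a b c : int) :
    m * a + (1 + m) * b + (1 + (1 + m)) * c = m * (2 * a + b) ->
    (m + 2) * (a + b + c) = (m + 1) * (2 * a + b).
  by apply: step; rewrite -!intS -!natz; exact: coef_trinomialX_rec.
move=> E; have -> : (m + 2) * (a + b + c)
  = m * a + (1 + m) * b + (1 + (1 + m)) * c + 2 * a + b by ring.
rewrite E; ring.
Qed.

Lemma sum_central_trinomial_sq (n : nat) :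
  \sum_(0 <= k < n.+1) (8%:Z * k%:Z + 5%:Z) * central_trinomial k ^+ 2
    = 2 * (n%:Z + 1) ^+ 2 * (next_coef n - central_trinomial n) ^+ 2
      + 3 * (n%:Z + 1) * central_trinomial n * central_trinomial n.+1.
Proof.
elim: n => [|n IHn].
  by rewrite big_nat1 central_trinomialS /central_trinomial /next_coef
             !expr0 !coef1.
rewrite big_nat_recr //= {}IHn !central_trinomialS (intS n).
have := next_coefS n.
move: (next_coef n.+1) (next_coef n) (central_trinomial n) => d' d c.
move: (n%:Z) => m E.
(* [E] only controls [(m + 2) * d'], so the factors [m + 2] are distributed until [d'] occurs in no
   other way. *)
have -> : 2 * (1 + m + 1) ^+ 2 * (d' - (c + 2 * d)) ^+ 2
    + 3 * (1 + m + 1) * (c + 2 * d) * (c + 2 * d + 2 * d')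
  = 2 * ((m + 2) * d' - (m + 2) * (c + 2 * d)) ^+ 2
    + 3 * (c + 2 * d) * ((m + 2) * (c + 2 * d) + 2 * ((m + 2) * d')) by ring.
rewrite E; ring.
Qed.

Lemma dvdz_pchar (R : nzRingType) (p : nat) (z : int) :
  p \in [pchar R] -> (p%:Z %| z)%Z = (z%:~R == 0 :> R).
Proof.
move=> pR; rewrite dvdzE /= (dvdn_pcharf pR).
case: z => n; first by [].
by rewrite NegzE abszN mulrNz oppr_eq0.
Qed.

Lemma legendre_mod (a : int) (q : nat) :
  legendre (a %% q%:Z)%Z q = legendre a q.
Proof. by rewrite /legendre !(sameP dvdz_mod0P eqP) modz_mod. Qed.

Lemma legendre3E (n : nat) : legendre n%:Z 3 = [:: 0; 1; -1]`_(n %% 3).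
Proof.
rewrite -legendre_mod modz_nat.
case: (n %% 3)%N (@ltn_pmod n 3 isT) => [|[|[|//]]] _ //=; rewrite /legendre /=.
  by case: existsP => // -[]; exists 1.
by case: existsP => // -[[[|[|[|//]]] lti3]].
Qed.

(** Three consecutive values are 0, 1, -1 in some cyclic order. The low coefficients of
    [trinomial R ^+ p.-1] obey the same recurrence. *)
Lemma legendre3_sum (n : nat) :
  legendre n.+2%:Z 3 = - (legendre n%:Z 3 + legendre n.+1%:Z 3).
Proof.
rewrite !legendre3E -addn2 -[n.+1]addn1 -(modnDml n) -[in RHS](modnDml n 1).
by move: (n %% 3)%N (@ltn_pmod n 3 isT) => [|[|[|]]].
Qed.

(** The Frobenius map of [{poly R}] is a ring morphism, hence acts termwise. *)
Lemma trinomialX_pchar (R : comNzRingType) (p : nat) (pR : p \in [pchar R]) :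
  trinomial R ^+ p = 'X^(2 * p) + 'X^p + 1.
Proof.
have pRX : p \in [pchar {poly R}] by rewrite pchar_poly.
rewrite -!(pFrobenius_autE pRX) !rmorphD rmorph1 rmorphXn /=.
by rewrite !pFrobenius_autE -exprM mulnC.
Qed.

Lemma central_trinomialE (R : comNzRingType) (n : nat) :
  (central_trinomial n)%:~R = (trinomial R ^+ n)`_n :> R.
Proof.
rewrite /central_trinomial -/(trinomial int) -(coef_map intr) rmorphXn /=.
by rewrite /trinomial !rmorphD rmorph1 /= map_polyXn map_polyX.
Qed.

Lemma central_trinomial_pchar (R : comNzRingType) (p : nat)
    (pR : p \in [pchar R]) :
  (central_trinomial p)%:~R = 1 :> R.
Proof.
have p_gt0 := prime_gt0 (pcharf_prime pR).
rewrite central_trinomialE (trinomialX_pchar _ _ pR) !coefD !coefXn coef1 eqxx.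
have -> : (p == 2 * p)%N = false by lia.
have -> : (p == 0)%N = false by lia.
by rewrite add0r addr0.
Qed.

Lemma coef_trinomialX_pred_pchar (R : comNzRingType) (p : nat)
    (pR : p \in [pchar R]) (k : nat) :
  (k < p)%N -> (trinomial R ^+ p.-1)`_k = (legendre k.+1%:Z 3)%:~R.
Proof.
set g := trinomial R ^+ p.-1 => ltkp.
have p_gt1 := prime_gt1 (pcharf_prime pR).
(* Below degree [p], the power [trinomial R ^+ p] has only its constant term 1. *)
have gM i : (i < p)%N -> (trinomial R * g)`_i = (i == 0%N)%:R.
  move=> ltip; rewrite -exprS prednK ?(ltnW p_gt1) // (trinomialX_pchar _ _ pR).
  rewrite !coefD !coefXn coef1.
  have -> : (i == 2 * p)%N = false by lia.
  have -> : (i == p)%N = false by lia.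
  by rewrite !add0r.
have g0 : g`_0 = 1 by rewrite -coef_trinomialM0 gM // ltnW.
have g1 : g`_1 = -1.
  by apply/eqP; rewrite -addr_eq0 addrC -g0 -coef_trinomialM1 gM.
elim/ltn_ind: k ltkp => -[|[|k]] IHk ltkp; rewrite legendre3E //.
rewrite -legendre3E legendre3_sum rmorphN rmorphD /= -!IHk //; try lia.
by apply/eqP; rewrite -addr_eq0 addrC -coef_trinomialM gM.
Qed.

Lemma central_trinomial_pred_pchar (R : comNzRingType) (p : nat)
    (pR : p \in [pchar R]) :
  (central_trinomial p.-1)%:~R = (legendre p%:Z 3)%:~R :> R.
Proof.
have p_gt0 := prime_gt0 (pcharf_prime pR).
by rewrite central_trinomialE (coef_trinomialX_pred_pchar _ _ pR) prednK.
Qed.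

Theorem corollary1p5 :
  (forall n : nat, (0 < n)%N ->
     (\sum_(0 <= k < n) (8%:Z * k%:Z + 5%:Z) * central_trinomial k ^+ 2
        = 0 %[mod n%:Z])%Z)
  /\
  (forall p : nat, prime p ->
     (\sum_(0 <= k < p) (8%:Z * k%:Z + 5%:Z) * central_trinomial k ^+ 2
        = (3%:Z * p%:Z * legendre p%:Z 3)%R %[mod (p%:Z ^+ 2)%R])%Z).
Proof.
split=> [[//|n] _|p p_pr].
  rewrite sum_central_trinomial_sq; apply/eqP; rewrite eqz_mod_dvd subr0.
  have -> : n%:Z + 1 = n.+1%:Z by rewrite intS addrC.
  apply: rpredD; last by rewrite dvdz_mulr // dvdz_mulr // dvdz_mull.
  by rewrite dvdz_mulr // dvdz_mull // dvdz_mulr.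
have pFp := pchar_Fp p_pr; apply/eqP; rewrite eqz_mod_dvd.
(* A factor [p] is already explicit in the closed form, so a congruence modulo [p], checked in
   ['F_p], suffices. *)
have := dvdz_pchar 'F_p p
  (central_trinomial p.-1 * central_trinomial p - legendre p%:Z 3) pFp.
rewrite rmorphB rmorphM /= (central_trinomial_pchar _ _ pFp) mulr1.
rewrite (central_trinomial_pred_pchar _ _ pFp) subrr eqxx.
case: p p_pr pFp => // n _ _ /dvdzP[q]; rewrite sum_central_trinomial_sq /=.
have -> : n%:Z + 1 = n.+1%:Z by rewrite intS addrC.
move=> /eqP; rewrite subr_eq => /eqP E.
(* The first summand comes from the square term, which carries [p ^+ 2]; the second from [3 * p]
   times the error [q * p]. *)
apply/dvdzP; exists (2 * (next_coef n - central_trinomial n) ^+ 2 + 3 * q).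
rewrite -(mulrA (3 * n.+1%:Z) (central_trinomial n)) E; ring.
Qed.
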